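(* For any $GL_2(K)$-invariant two-sided ideal $I$ of $K\langle x,y\rangle$, the algebra of constants $(K\langle x,y\rangle/I)^{\delta}$, where $\delta(x)=0$, $\delta(y)=x$, is generated by $x$ and by $SL_2(K)$-invariants.
   Context: $K$ is a field of characteristic $0$ and $K\langle x,y\rangle$ is the free unitary associative $K$-algebra on $x,y$. $GL_2(K)$ acts naturally on the vector space $Kx\oplus Ky$ and diagonally on $K\langle x,y\rangle$ by algebra automorphisms, hence on $K\langle x,y\rangle/I$ for $GL_2(K)$-invariant ideals $I$; $SL_2(K)$-invariants are the elements fixed by $SL_2(K)\subset GL_2(K)$. $\delta$ is the derivation of $K\langle x,y\rangle$ with $\delta(x)=0$, $\delta(y)=x$ and also the derivation it induces on $K\langle x,y\rangle/I$; $(K\langle x,y\rangle/I)^\delta$ is its kernel. The images of $x,y$ in $K\langle x,y\rangle/I$ are denoted by the same symbols. *)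

(* Defs.v *)
From HB Require Import structures.
From mathcomp Require Import all_boot all_order all_algebra.
From mathcomp Require Import finmap.
From mathcomp Require Import boolp monalg.

Set Implicit Arguments.
Unset Strict Implicit.
Unset Printing Implicit Defensive.

Import GRing.Theory.
Local Open Scope ring_scope.
Local Open Scope quotient_scope.

(* K<x,y> is the monoid algebra of the free monoid on two letters.            *)
Definition freeAlg (K : fieldType) := {malg K[{fmonom 'I_2}]}.

HB.instance Definition _ (K : fieldType) := GRing.Zmodule.on (freeAlg K).

Section FreeAlgebra.
Variable K : fieldType.
Implicit Types (f g : freeAlg K) (m : {fmonom 'I_2}) (w : seq 'I_2) (i : 'I_2).

(* Scaling and product are those of the monoid algebra, locked because        *)
(* failing unifications otherwise compute them and become very slow.          *)
Fact freeAlg_key : unit. Proof. by []. Qed.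
Definition freeAlg_scale : K -> freeAlg K -> freeAlg K :=
  locked_with freeAlg_key (@fgscale _ K).
Definition freeAlg_mul : freeAlg K -> freeAlg K -> freeAlg K :=
  locked_with freeAlg_key (@fgmul _ K).
Definition freeAlg_one : freeAlg K := fgone _ K.

Lemma freeAlg_mulE : freeAlg_mul = @fgmul _ K.
Proof. by rewrite /freeAlg_mul unlock. Qed.

Lemma freeAlg_scaleE : freeAlg_scale = @fgscale _ K.
Proof. by rewrite /freeAlg_scale unlock. Qed.

Lemma freeAlg_scaleA c1 c2 f :
  freeAlg_scale c1 (freeAlg_scale c2 f) = freeAlg_scale (c1 * c2) f.
Proof. by rewrite freeAlg_scaleE; apply: fgscaleA. Qed.

Lemma freeAlg_scale1 : left_id 1 freeAlg_scale.
Proof. by rewrite freeAlg_scaleE; apply: fgscale1r. Qed.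

Lemma freeAlg_scaleDr : right_distributive freeAlg_scale +%R.
Proof. by rewrite freeAlg_scaleE; apply: fgscaleDr. Qed.

Lemma freeAlg_scaleDl f : {morph freeAlg_scale^~ f : c1 c2 / c1 + c2}.
Proof. by rewrite freeAlg_scaleE; apply: fgscaleDl. Qed.

HB.instance Definition _ := GRing.Zmodule_isLmodule.Build K (freeAlg K)
  freeAlg_scaleA freeAlg_scale1 freeAlg_scaleDr freeAlg_scaleDl.

Lemma scale_malgE (c : K) f : c *: f = fgscale c f.
Proof. by rewrite -freeAlg_scaleE. Qed.

Lemma coeffZ (c : K) f m : (c *: f)@_m = c * f@_m.
Proof. by rewrite scale_malgE fgscaleE. Qed.

Lemma freeAlg_mulA : associative freeAlg_mul.
Proof. by rewrite freeAlg_mulE; apply: fgmulA. Qed.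

Lemma freeAlg_mul1f : left_id freeAlg_one freeAlg_mul.
Proof. by rewrite freeAlg_mulE; apply: fgmul1g. Qed.

Lemma freeAlg_mulf1 : right_id freeAlg_one freeAlg_mul.
Proof. by rewrite freeAlg_mulE; apply: fgmulg1. Qed.

Lemma freeAlg_mulDl : left_distributive freeAlg_mul +%R.
Proof. by rewrite freeAlg_mulE; apply: fgmulgDl. Qed.

Lemma freeAlg_mulDr : right_distributive freeAlg_mul +%R.
Proof. by rewrite freeAlg_mulE; apply: fgmulgDr. Qed.

Lemma freeAlg_oner_neq0 : freeAlg_one != 0.
Proof. exact: fgoner_eq0. Qed.

HB.instance Definition _ := GRing.Zmodule_isNzRing.Build (freeAlg K)
  freeAlg_mulA freeAlg_mul1f freeAlg_mulf1 freeAlg_mulDl freeAlg_mulDr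
  freeAlg_oner_neq0.

Lemma mul_malgE f g : f * g = fgmul f g.
Proof. by rewrite -freeAlg_mulE. Qed.

Lemma freeAlg_scalerAl (c : K) f g :
  c *: freeAlg_mul f g = freeAlg_mul (c *: f) g.
Proof.
rewrite !scale_malgE freeAlg_mulE; exact: (@fgscaleAl {fmonom 'I_2} K).
Qed.

HB.instance Definition _ :=
  GRing.Lmodule_isLalgebra.Build K (freeAlg K) freeAlg_scalerAl.

Lemma freeAlg_scalerAr (c : K) f g :
  c *: freeAlg_mul f g = freeAlg_mul f (c *: g).
Proof.
rewrite freeAlg_mulE /fgmul scaler_sumr; apply: eq_bigr => m1 _.
have le : (msupp (c *: g) `<=` msupp g)%fset.
  by rewrite scale_malgE; apply: msuppZ_le.
rewrite (big_fset_incl _ le) /=.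
  rewrite scaler_sumr; apply: eq_bigr => m2 _; apply/malgP => m.
  rewrite [LHS]coeffZ [RHS]mcoeffU [X in _ * X = _]mcoeffU coeffZ.
  by rewrite mulrCA mulrnAr.
by move=> m _ /mcoeff_outdom ->; rewrite mulr0 monalgU0.
Qed.

HB.instance Definition _ :=
  GRing.Lalgebra_isAlgebra.Build K (freeAlg K) freeAlg_scalerAr.

Definition gen i : freeAlg K := << fmu i >>.

Definition genx : freeAlg K := gen ord0.
Definition geny : freeAlg K := gen ord_max.

Definition wordM w : freeAlg K := \prod_(i <- w) gen i.

Lemma wordME m : wordM m = << m >>.
Proof.
rewrite /wordM; case: m => w /=; elim: w => [|i w IHw].
  by rewrite big_nil -fmoneE.
rewrite big_cons IHw /gen mul_malgE fgmulUU mulr1.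
by rewrite /mmul /mul /= fmmulE fmuE.
Qed.

Lemma monomE (c : K) m : << c *g m >> = c *: wordM m :> freeAlg K.
Proof.
rewrite wordME; apply/malgP => k; rewrite [LHS]mcoeffU [RHS]coeffZ.
by rewrite [X in _ = _ * X]mcoeffU mulrnAr mulr1.
Qed.

Lemma freeAlg_word_ind (P : freeAlg K -> Prop) :
    (forall f g, P f -> P g -> P (f + g)) -> (forall c f, P f -> P (c *: f)) ->
    (forall w, P (wordM w)) ->
  forall f, P f.
Proof.
move=> PD PZ Pw f; rewrite [f]monalgE; apply: big_ind => // [|m _].
  by have := PZ 0 _ (Pw [::]); rewrite scale0r.
by rewrite monomE; apply: PZ.
Qed.

Lemma freeAlg_ind (P : freeAlg K -> Prop) :
    (forall f g, P f -> P g -> P (f + g)) -> (forall c f, P f -> P (c *: f)) ->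
    P 1 -> (forall i f, P f -> P (gen i * f)) ->
  forall f, P f.
Proof.
move=> PD PZ P1 PM; apply: freeAlg_word_ind => // w.
rewrite /wordM; elim: w => [|i w IHw]; first by rewrite big_nil.
by rewrite big_cons; apply: PM.
Qed.

(* The linear extension of a map given on the basis of words.                 *)
Section Extension.
Variable A : algType K.
Implicit Types (h : seq 'I_2 -> A) (u : 'I_2 -> A).

Definition linext h : freeAlg K -> A :=
  mmap (in_alg A) (fun m => h (fmonom_val m)).

Lemma linext_is_linear h : linear (linext h).
Proof.
move=> c f g; rewrite /linext mmapD; congr (_ + _).
rewrite scale_malgE (mmapEw (msuppZ_le _ _)) mmapE scaler_sumr; apply: eq_bigr => m _.
by rewrite fgscaleE /= -scalerA -scalerAl.
Qed.
HB.instance Definition _ h :=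
  GRing.isLinear.Build K (freeAlg K) A _ (linext h) (linext_is_linear h).

Lemma linext_wordM h w : linext h (wordM w) = h w.
Proof.
rewrite -[w]/(fmonom_val (FMonom w)) wordME /linext mmapU.
by rewrite /= scale1r mul1r.
Qed.

(* The algebra homomorphism sending each generator i to u i.                  *)
Definition subst u : freeAlg K -> A := linext (fun w => \prod_(i <- w) u i).

HB.instance Definition _ u := GRing.Linear.on (subst u).

Lemma substD u : {morph subst u : f g / f + g}.
Proof. exact: linearD. Qed.

Lemma substZ u c : {morph subst u : f / c *: f}.
Proof. by move=> f; apply: linearZ. Qed.

Lemma subst1 u : subst u 1 = 1.
Proof.
have -> : 1 = wordM [::] by rewrite /wordM big_nil.
by rewrite /subst linext_wordM big_nil.
Qed.

Lemma subst_genM u i f : subst u (gen i * f) = u i * subst u f.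
Proof.
elim/freeAlg_word_ind: f => [f1 f2 h1 h2|c f hf|w].
- rewrite mulrDr !substD h1 h2 mulrDr; reflexivity.
- rewrite -scalerAr !substZ hf scalerAr; reflexivity.
have -> : gen i * wordM w = wordM (i :: w) by rewrite /wordM big_cons.
by rewrite /subst !linext_wordM big_cons.
Qed.

Lemma subst_is_monoid_morphism u : monoid_morphism (subst u).
Proof.
split=> [|f g]; first exact: subst1.
elim/freeAlg_ind: f => [f1 f2 h1 h2|c f hf||i f hf].
- rewrite mulrDl !substD h1 h2 mulrDl; reflexivity.
- rewrite -scalerAl !substZ hf scalerAl; reflexivity.
- rewrite subst1 !mul1r; reflexivity.
- rewrite -mulrA !subst_genM hf mulrA; reflexivity.
Qed.
HB.instance Definition _ u :=
  GRing.isMonoidMorphism.Build (freeAlg K) A (subst u)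
    (subst_is_monoid_morphism u).

Lemma subst_gen u i : subst u (gen i) = u i.
Proof.
have -> : gen i = wordM [:: i] by rewrite /wordM big_seq1.
by rewrite /subst linext_wordM big_seq1.
Qed.
End Extension.

(* The value on a word of the derivation with gen i |-> d i.                  *)
Fixpoint word_deriv (d : 'I_2 -> freeAlg K) w : freeAlg K :=
  if w is i :: w' then d i * wordM w' + gen i * word_deriv d w' else 0.

Definition delta : freeAlg K -> freeAlg K :=
  linext (word_deriv (fun i => if i == ord0 then 0 else genx)).

HB.instance Definition _ := GRing.Linear.on delta.

Lemma deltaD : {morph delta : f g / f + g}.
Proof. exact: linearD. Qed.

Lemma deltaZ c : {morph delta : f / c *: f}.
Proof. by move=> f; apply: linearZ. Qed.

Lemma delta1 : delta 1 = 0.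
Proof.
have -> : 1 = wordM [::] by rewrite /wordM big_nil.
by rewrite /delta linext_wordM.
Qed.

Lemma delta_genM i f :
  delta (gen i * f) = (if i == ord0 then 0 else genx) * f + gen i * delta f.
Proof.
elim/freeAlg_word_ind: f => [f1 f2 h1 h2|c f hf|w].
- rewrite !(mulrDr _ f1) !deltaD h1 h2 (mulrDr _ (delta f1)) addrACA.
  reflexivity.
- rewrite -!(scalerAr c _ f) !deltaZ hf -(scalerAr c _ (delta f)) -scalerDr.
  reflexivity.
have -> : gen i * wordM w = wordM (i :: w) by rewrite /wordM big_cons.
by rewrite /delta !linext_wordM.
Qed.

Lemma delta_genx : delta genx = 0.
Proof. by rewrite -[genx]mulr1 delta_genM delta1 eqxx mul0r mulr0 addr0. Qed.

Lemma delta_geny : delta geny = genx.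
Proof. by rewrite -[geny]mulr1 delta_genM delta1 /= mulr0 addr0 mulr1. Qed.

Lemma deltaM f g : delta (f * g) = delta f * g + f * delta g.
Proof.
elim/freeAlg_ind: f => [f1 f2 h1 h2|c f hf||i f hf].
- rewrite (mulrDl f1) !deltaD h1 h2 (mulrDl (delta f1)) (mulrDl f1) addrACA.
  reflexivity.
- rewrite -!(scalerAl c f) !deltaZ hf -(scalerAl c (delta f)) -scalerDr.
  reflexivity.
- rewrite delta1 mul0r !mul1r add0r; reflexivity.
- rewrite -mulrA !delta_genM hf (mulrDl (_ * f)) (mulrDr (gen i)) !mulrA addrA.
  reflexivity.
Qed.

(* g acts on Kx + Ky by g.e_j = \sum_i g_ij e_i, where e_0 = x and e_1 = y.   *)
Definition gl_act (g : 'M[K]_2) : freeAlg K -> freeAlg K :=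
  subst (fun j => \sum_i g i j *: gen i).

HB.instance Definition _ (g : 'M[K]_2) := GRing.LRMorphism.on (gl_act g).

(* Two-sided ideals; the whole algebra is allowed.                            *)
Record ideal := Ideal {
  in_ideal :> freeAlg K -> Prop;
  ideal0 : in_ideal 0;
  idealD f g : in_ideal f -> in_ideal g -> in_ideal (f + g);
  idealMl f g : in_ideal g -> in_ideal (f * g);
  idealMr f g : in_ideal f -> in_ideal (f * g)
}.

Definition GL2_invariant (I : ideal) : Prop :=
  forall g : 'M[K]_2, g \in unitmx -> forall f, I f -> I (gl_act g f).

End FreeAlgebra.

Section Quotient.
Variables (K : fieldType) (I : ideal K).
Implicit Types (f g : freeAlg K).

Lemma idealN f : I f -> I (- f).
Proof. by rewrite -mulN1r; apply: idealMl. Qed.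

Lemma idealZ c f : I f -> I (c *: f).
Proof. by rewrite -mulr_algl; apply: idealMl. Qed.

Definition ideal_pred : {pred freeAlg K} := fun f => `[< I f >].

Lemma ideal_predP f : reflect (I f) (f \in ideal_pred).
Proof. exact: asboolP. Qed.

Lemma ideal_zmod_closed : zmod_closed ideal_pred.
Proof.
split=> [|f g /ideal_predP If /ideal_predP Ig]; apply/ideal_predP.
  exact: ideal0.
by apply: idealD => //; apply: idealN.
Qed.
HB.instance Definition _ :=
  GRing.isZmodClosed.Build (freeAlg K) ideal_pred ideal_zmod_closed.

Definition quotAlg := Quotient.quot ideal_pred.

HB.instance Definition _ := GRing.Zmodule.on quotAlg.
HB.instance Definition _ := Quotient.on quotAlg.

Definition proj f : quotAlg := \pi_quotAlg f.

Lemma projP f g : proj f = proj g <-> I (f - g).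
Proof.
rewrite /proj; split=> [/eqP|Ifg].
  by rewrite -Quotient.idealrBE => /ideal_predP.
by apply/eqP; rewrite -Quotient.idealrBE; apply/ideal_predP.
Qed.

Lemma proj_eq0 f : proj f = 0 <-> I f.
Proof.
have -> : 0 = proj 0 by rewrite /proj !piE.
by rewrite projP subr0.
Qed.

Lemma repr_proj (a : quotAlg) : proj (repr a) = a.
Proof. exact: reprK. Qed.
Lemma projD f g : proj (f + g) = proj f + proj g.
Proof. by rewrite /proj !piE. Qed.

Definition quot_one : quotAlg := proj 1.
Definition quot_mul (a b : quotAlg) : quotAlg := proj (repr a * repr b).
Definition quot_scale (c : K) (a : quotAlg) : quotAlg := proj (c *: repr a).

Lemma repr_projP f : I (repr (proj f) - f).
Proof. by apply/projP; apply: repr_proj. Qed.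

Lemma quot_mulE f g : quot_mul (proj f) (proj g) = proj (f * g).
Proof.
apply/projP; set f' := repr _; set g' := repr _.
have -> : f' * g' - f * g = (f' - f) * g' + f * (g' - g).
  by rewrite mulrBl mulrBr addrA subrK.
by apply: idealD; [apply: idealMr | apply: idealMl]; apply: repr_projP.
Qed.

Lemma quot_scaleE c f : quot_scale c (proj f) = proj (c *: f).
Proof.
by apply/projP; rewrite -scalerBr; apply: idealZ; apply: repr_projP.
Qed.

Lemma quot_mulA : associative quot_mul.
Proof.
move=> a b c; rewrite -(repr_proj a) -(repr_proj b) -(repr_proj c).
by rewrite !quot_mulE mulrA.
Qed.

Lemma quot_mul1a : left_id quot_one quot_mul.
Proof. by move=> a; rewrite -(repr_proj a) quot_mulE mul1r. Qed.

Lemma quot_mula1 : right_id quot_one quot_mul.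
Proof. by move=> a; rewrite -(repr_proj a) quot_mulE mulr1. Qed.

Lemma quot_mulDl : left_distributive quot_mul +%R.
Proof.
move=> a b c; rewrite -(repr_proj a) -(repr_proj b) -(repr_proj c).
by rewrite -projD !quot_mulE mulrDl projD.
Qed.

Lemma quot_mulDr : right_distributive quot_mul +%R.
Proof.
move=> a b c; rewrite -(repr_proj a) -(repr_proj b) -(repr_proj c).
by rewrite -projD !quot_mulE mulrDr projD.
Qed.

HB.instance Definition _ := GRing.Zmodule_isPzRing.Build quotAlg
  quot_mulA quot_mul1a quot_mula1 quot_mulDl quot_mulDr.

Lemma quot_scaleA c1 c2 (a : quotAlg) :
  quot_scale c1 (quot_scale c2 a) = quot_scale (c1 * c2) a.
Proof. by rewrite -(repr_proj a) !quot_scaleE scalerA. Qed.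

Lemma quot_scale1 : left_id 1 quot_scale.
Proof. by move=> a; rewrite -(repr_proj a) quot_scaleE scale1r. Qed.

Lemma quot_scaleDr : right_distributive quot_scale +%R.
Proof.
move=> c a b; rewrite -(repr_proj a) -(repr_proj b).
by rewrite -projD !quot_scaleE scalerDr projD.
Qed.

Lemma quot_scaleDl a : {morph quot_scale^~ a : c1 c2 / c1 + c2}.
Proof.
by move=> c1 c2; rewrite -(repr_proj a) !quot_scaleE scalerDl projD.
Qed.

HB.instance Definition _ := GRing.Zmodule_isLmodule.Build K quotAlg
  quot_scaleA quot_scale1 quot_scaleDr quot_scaleDl.

Lemma proj_one : proj 1 = 1.
Proof. by []. Qed.

Lemma projM f g : proj (f * g) = proj f * proj g.
Proof. by rewrite -quot_mulE. Qed.

Lemma projZ c f : proj (c *: f) = c *: proj f.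
Proof. by rewrite -quot_scaleE. Qed.

(* The induced action and derivation; see [quot_actE] and [quot_deltaE] for   *)
(* their independence of the representatives.                                 *)
Definition quot_act (g : 'M[K]_2) (a : quotAlg) : quotAlg :=
  proj (gl_act g (repr a)).

Definition quot_delta (a : quotAlg) : quotAlg := proj (delta (repr a)).

Definition SL2_invariant (a : quotAlg) : Prop :=
  forall g : 'M[K]_2, \det g = 1 -> quot_act g a = a.

Definition is_constant (a : quotAlg) : Prop := quot_delta a = 0.

(* The unitary subalgebra generated by S.                                     *)
Inductive subalgebra_of (S : quotAlg -> Prop) : quotAlg -> Prop :=
| subalg_gen a : S a -> subalgebra_of S a
| subalg_one : subalgebra_of S 1
| subalg_add a b :
    subalgebra_of S a -> subalgebra_of S b -> subalgebra_of S (a + b)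
| subalg_scale c a : subalgebra_of S a -> subalgebra_of S (c *: a)
| subalg_mul a b :
    subalgebra_of S a -> subalgebra_of S b -> subalgebra_of S (a * b).

Section WellDefined.
Hypotheses (charK : [pchar K] =i pred0) (invI : GL2_invariant I).

Lemma quot_actE (g : 'M[K]_2) f :
  g \in unitmx -> quot_act g (proj f) = proj (gl_act g f).
Proof.
move=> ug; apply/projP; rewrite -(raddfB (gl_act g)).
by apply: invI => //; apply: repr_projP.
Qed.

(* x |-> x and y |-> y + t x *)
Let unip (t : K) : 'M[K]_2 :=
  \matrix_(i, j) (if i == j then 1 else if i == ord0 then t else 0).

Let unip_unit t : unip t \in unitmx.
Proof.
rewrite unitmxE -det_tr det_trig.
  by rewrite !big_ord_recl big_ord0 !mxE !mulr1 unitr1.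
apply/is_trig_mxP => i j; rewrite !mxE; case: j i => [[|[|//]] ?] [[|//] ?] //.

Qed.

Let unip_gen t i :
  gl_act (unip t) (gen K i) = gen K i + t *: (if i == ord0 then 0 else genx K).
Proof.
rewrite /gl_act subst_gen !big_ord_recl big_ord0 addr0 !mxE.
case: i => [[|[|//]] lti] /=; rewrite ?scale0r ?scaler0 ?scale1r ?addr0.
  by congr (gen K _); apply: val_inj.
by rewrite addrC; congr (gen K _ + _); apply: val_inj.
Qed.

Let unip_poly f : exists p : {poly freeAlg K}, [/\ p`_0 = f, p`_1 = delta f &
  forall t, gl_act (unip t) f = p.[t%:A]].
Proof.
have comm_alg t (p : {poly freeAlg K}) : comm_poly p t%:A.
  by rewrite /comm_poly mulr_algl mulr_algr.
elim/freeAlg_ind: f => [f g [p [p0 p1 pE]] [q [q0 q1 qE]]|c f [p [p0 p1 pE]]||].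
- exists (p + q); rewrite !coefD p0 p1 q0 q1 deltaD; split=> // t.
  rewrite hornerD -pE -qE; exact: substD.
- exists (c%:A%:P * p); rewrite !coefCM p0 p1 !mulr_algl deltaZ; split=> // t.
  by rewrite hornerM_comm // hornerC -pE mulr_algl; apply: substZ.
- exists 1%:P; rewrite !coefC delta1; split=> // t.
  by rewrite hornerC; apply: subst1.
move=> i f [p [p0 p1 pE]].
pose q : {poly freeAlg K} :=
  (gen K i)%:P + (if i == ord0 then 0 else genx K)%:P * 'X.
have q0 : q`_0 = gen K i by rewrite coefD coefC coefMX addr0.
have q1 : q`_1 = if i == ord0 then 0 else genx K.
  by rewrite coefD coefC coefMX coefC add0r.
exists (q * p); rewrite !coefM !big_ord_recl !big_ord0 /= !addr0 q0 q1 p0 p1.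
split=> // [|t]; first by rewrite delta_genM addrC.
rewrite hornerM_comm // -pE (rmorphM (gl_act (unip t))) /= unip_gen.
by rewrite hornerD hornerC hornerMX hornerC mulr_algr.
Qed.

Lemma delta_ideal f : I f -> I (delta f).
Proof.
move=> If; have [p [p0 p1 pE]] := unip_poly f.
pose n := (size p).+2; pose V := Vandermonde n (\row_(j < n) j%:R : 'rV[K]_n).
have uV : V \in unitmx.
  rewrite unitmxE det_Vandermonde unitfE.
  apply/prodf_neq0 => i _; apply/prodf_neq0 => j ij; rewrite !mxE -natrB 1?ltnW //.
  by rewrite ((iffLR (pcharf0P K)) charK) -lt0n subn_gt0.
pose b := invmx V *m delta_mx (1 : 'I_n) (0 : 'I_1).
have Vb (k : 'I_n) : \sum_(j < n) j%:R ^+ k * b j 0 = (k == 1)%:R.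
  have := congr1 (fun M : 'cV_n => M k 0) (mulKVmx uV (delta_mx 1 0 : 'cV_n)).
  rewrite !mxE eqxx andbT => <-.
  by apply: eq_bigr => j _; rewrite !mxE.
have -> : delta f = \sum_(j < n) b j 0 *: p.[(j%:R : K)%:A].
  transitivity (\sum_(k < n) (k == 1 :> 'I_n)%:R *: p`_k).
    rewrite (bigD1 1) // eqxx scale1r big1 => [|k /negPf ->].
      by rewrite /= addr0.
    by rewrite scale0r.
  under eq_bigr => k _ do rewrite -Vb scaler_suml.
  rewrite exchange_big /=; apply: eq_bigr => j _.
  rewrite (@horner_coef_wide _ n) ?leqW // scaler_sumr.
  apply: eq_bigr => k _.
  by rewrite -(rmorphXn (in_alg _)) /= mulr_algr scalerA mulrC.
apply: big_ind => [||j _]; [exact: ideal0 | exact: idealD|].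
by apply: idealZ; rewrite -pE; apply: invI.
Qed.

Lemma quot_deltaE f : quot_delta (proj f) = proj (delta f).
Proof.
apply/projP; rewrite -(raddfB (@delta K)).
by apply: delta_ideal; apply: repr_projP.
Qed.
End WellDefined.
End Quotient.

(* Main.v *)
From HB Require Import structures.
Require Import Defs.
From mathcomp Require Import all_boot all_order all_algebra.
From mathcomp Require Import finmap monalg.
From mathcomp Require Import ring zify.

Set Implicit Arguments.
Unset Strict Implicit.
Unset Printing Implicit Defensive.

Import GRing.Theory.
Local Open Scope ring_scope.

(** Write e for delta, f for the derivation x |-> y, y |-> 0, and h for the
    derivation x |-> x, y |-> -y.  They satisfy the relations of sl_2 and all
    three preserve I, so the constants are the sums of highest weight vectors of
    an sl_2-module.

    Lifting.  If e v lies in I, then v is congruent modulo I to an element of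
    the free algebra killed by e.  As I is stable under h, the weight components
    of v may be treated separately ([eigencomponents_mem]).  In a weight m >= 0
    the extremal projector, a series in the f^k e^k with leading term 1, turns v
    into a highest weight vector ([lift_highest_weight]); in a negative weight v
    itself lies in I, because f is locally nilpotent ([negative_weight_mem]).

    The free algebra.  Write [cup u] for y u x - x u y; it is fixed by SL_2 as
    soon as u is, being alternating in (x, y).  A highest weight vector
    v = c + x a + y b satisfies e b = 0 and b = - e a.  When v has weight
    m >= 0, b has weight m + 1 > 0, the vector a0 = a + (m + 1)^-1 f b is again
    of highest weight, and
      v = c + x a0 + (m + 1)^-1 (y h b - x f b).
    By induction on the degree a0 and b are spanned by products of x's and of
    iterated cups, and the operator u |-> y h u - x f u preserves the span of
    such products ([noncrossing_transvection]): this is the basis of highest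
    weight vectors by noncrossing matchings of the letters, the unmatched
    letters being x's.

    Conversely, x is a constant, the constants form a subalgebra, and the matrix
    fixing x and sending y to x + y acts as exp e; as e is locally nilpotent,
    (exp e - 1) v in I forces e v in I ([unipotent_mem]). *)

(** * Stable subspaces *)

Section Subspaces.
Variables (K : fieldType) (V : lmodType K).

Definition subspace (U : V -> Prop) : Prop :=
  [/\ U 0, forall u v, U u -> U v -> U (u + v) & forall c u, U u -> U (c *: u)].

Definition stable (L : V -> V) (U : V -> Prop) : Prop :=
  forall v, U v -> U (L v).

Lemma subspaceN U v : subspace U -> U v -> U (- v).
Proof. by case=> _ _ UZ Uv; rewrite -scaleN1r; apply: UZ. Qed.

Lemma subspaceB U u v : subspace U -> U u -> U v -> U (u - v).
Proof.
by move=> sU Uu Uv; case: (sU) => _ UD _; apply: UD => //; apply: subspaceN.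
Qed.

Lemma subspace_scale_inv (U : V -> Prop) c v :
  subspace U -> c != 0 -> U (c *: v) -> U v.
Proof. by case=> _ _ UZ c0 /(UZ c^-1); rewrite scalerA mulVf // scale1r. Qed.

Lemma subspace_sum (I : Type) (r : seq I) (P : pred I) (U : V -> Prop)
    (F : I -> V) :
  subspace U -> (forall i, P i -> U (F i)) -> U (\sum_(i <- r | P i) F i).
Proof. by case=> U0 UD _ UF; apply: big_ind. Qed.

Lemma stable_iter (L : V -> V) U k : stable L U -> stable (iter k L) U.
Proof. by move=> LU v Uv; elim: k => //= k; apply: LU. Qed.

(** Applying L - z0 kills one summand and rescales the others by nonzero
    factors, so the number of summands goes down. *)
Lemma eigenvectors_mem (L : {linear V -> V}) (U : V -> Prop) (s : seq K) F :
    subspace U -> stable L U -> uniq s -> (forall z, L (F z) = z *: F z) ->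
    U (\sum_(z <- s) F z) ->
  forall z, z \in s -> U (F z).
Proof.
move=> sU LU; elim: s F => // z0 s IHs F /= /andP[z0s us] LF.
rewrite big_cons => Usum.
have Us z : z \in s -> U (F z).
  move=> zs; apply: (@subspace_scale_inv _ (z - z0)) => //.
    by rewrite subr_eq0; apply: contraNneq z0s => <-.
  apply: (IHs (fun z => (z - z0) *: F z)) => // [z'|].
    by rewrite linearZ /= LF !scalerA mulrC.
  have -> : \sum_(j <- s) (j - z0) *: F j =
      L (F z0 + \sum_(j <- s) F j) - z0 *: (F z0 + \sum_(j <- s) F j).
    rewrite linearD LF scalerDr opprD addrACA subrr add0r linear_sum.
    rewrite scaler_sumr -sumrB.
    by apply: eq_bigr => j _; rewrite LF scalerBl.
  by apply: subspaceB => //; [apply: LU | case: sU => _ _; apply].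
move=> z; rewrite inE => /predU1P[->|/Us //].
rewrite -[F z0](addrK (\sum_(j <- s) F j)); apply: subspaceB => //.
by rewrite big_seq; apply: subspace_sum => // j /Us.
Qed.

Lemma sum_by_eigenvalue (I : eqType) (r : seq I) (mu : I -> K) (w : I -> V) :
  \sum_(i <- r) w i =
  \sum_(z <- undup (map mu r)) \sum_(i <- r | mu i == z) w i.
Proof.
under [RHS]eq_bigr => z _ do rewrite big_mkcond.
rewrite exchange_big /= big_seq [RHS]big_seq; apply: eq_bigr => i ir.
rewrite (bigD1_seq (mu i)) ?undup_uniq ?mem_undup ?map_f //= eqxx.
by rewrite big1 ?addr0 // => z /negPf; rewrite eq_sym => ->.
Qed.

Lemma eigencomponents_mem (L : {linear V -> V}) (U : V -> Prop) (I : eqType)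
    (r : seq I) (mu : I -> K) (w : I -> V) :
    subspace U -> stable L U -> (forall i, L (w i) = mu i *: w i) ->
    U (\sum_(i <- r) w i) ->
  forall z, U (\sum_(i <- r | mu i == z) w i).
Proof.
move=> sU LU Lw; rewrite (sum_by_eigenvalue r mu) => Usum z.
have [zr|zr] := boolP (z \in undup (map mu r)).
  apply: (eigenvectors_mem sU LU (undup_uniq _) _ Usum) => // t.
  rewrite linear_sum scaler_sumr; apply: eq_bigr => i /eqP <-; exact: Lw.
rewrite big1_seq => [|i]; first by case: sU.
by case/andP=> /eqP iz ir; rewrite -iz mem_undup map_f in zr.
Qed.

(** The sum is L times a series in L whose constant term c 0 is invertible.
    As L is nilpotent at v this series could be inverted; instead the powers
    L^(k+1) v are shown to lie in U from the highest down, applying L^k to the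
    sum to isolate each one. *)
Lemma unipotent_mem (L : {linear V -> V}) (U : V -> Prop) N (c : nat -> K) v :
    subspace U -> stable L U -> c 0%N != 0 ->
    (forall k, (N <= k)%N -> iter k.+1 L v = 0) ->
    U (\sum_(k < N) c k *: iter k.+1 L v) ->
  U (L v).
Proof.
move=> sU LU c0 LN Usum; case: (sU) => U0 _ UZ.
suff: forall j k, (N - j <= k)%N -> U (iter k.+1 L v).
  by move/(_ N 0%N); apply; rewrite subnn.
elim=> [|j IHj] k; first by rewrite subn0 => /LN ->.
have [/IHj //|kj] := leqP (N - j) k; move=> Njk.
apply: (subspace_scale_inv sU c0).
have kN : (k < N)%N by apply: leq_trans kj (leq_subr _ _).
case: N kN {LN kj} Njk IHj Usum => // N _ Njk IHj.
rewrite big_ord_recl => /(stable_iter k LU).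
set w := \sum_(_ < _) _ => Uw.
have LkD u1 u2 : iter k L (u1 + u2) = iter k L u1 + iter k L u2.
  by elim: (k) => // i IHi; rewrite !iterS IHi linearD.
have LkZ d u : iter k L (d *: u) = d *: iter k L u.
  by elim: (k) => // i IHi; rewrite !iterS IHi linearZ_LR.
have <- : iter k L (c 0%N *: L v + w) - iter k L w = c 0%N *: iter k.+1 L v.
  by rewrite LkD addrK LkZ iterSr.
apply: subspaceB => //; rewrite /w.
elim/big_rec: _ => [|i u _ Uu].
  by have := LkZ 0 0; rewrite !scale0r => ->.
rewrite LkD LkZ; case: (sU) => _ UD _; apply: UD => //; apply: UZ.
rewrite -iterD addnS; apply: IHj; rewrite lift0; lia.
Qed.
End Subspaces.

(** * Highest weight vectors for sl_2 *)

Section Sl2.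
Variables (K : fieldType) (V : lmodType K) (e f h : {linear V -> V}).
Hypothesis charK : [pchar K] =i pred0.
Hypothesis efE : forall v, e (f v) = f (e v) + h v.
Hypothesis heE : forall v, h (e v) = e (h v) + 2 *: e v.
Hypothesis hfE : forall v, h (f v) = f (h v) - 2 *: f v.

Lemma natrS_neq0 n : n.+1%:R != 0 :> K.
Proof. by rewrite ((iffLR (pcharf0P K)) charK). Qed.

Lemma weight_iter_e k mu v :
  h v = mu *: v -> h (iter k e v) = (mu + (2 * k)%:R) *: iter k e v.
Proof.
move=> hv; elim: k => [|k IHk] /=; first by rewrite muln0 addr0.
by rewrite heE IHk linearZ /= -scalerDl mulnS natrD; congr (_ *: _); ring.
Qed.

Lemma weight_iter_f k mu v :
  h v = mu *: v -> h (iter k f v) = (mu - (2 * k)%:R) *: iter k f v.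
Proof.
move=> hv; elim: k => [|k IHk] /=; first by rewrite muln0 subr0.
by rewrite hfE IHk linearZ /= -scalerBl mulnS natrD; congr (_ *: _); ring.
Qed.

Lemma e_iter_f k mu v : h v = mu *: v ->
  e (iter k.+1 f v) =
  iter k.+1 f (e v) + (k.+1%:R * (mu - k%:R)) *: iter k f v.
Proof.
move=> hv; elim: k => [|k IHk]; first by rewrite /= efE hv subr0 mul1r.
rewrite iterS efE IHk linearD linearZ /= -addrA; congr (_ + _).
rewrite -iterS (weight_iter_f k.+1 hv) -scalerDl; congr (_ *: _).
rewrite natrM -[k.+2]addn2 -[k.+1]addn1 !natrD; ring.
Qed.

(** Modulo U, v is a highest weight vector, so e f^(k+1) v is a nonzero multiple
    of f^k v: all the coefficients of [e_iter_f] are nonzero in negative weight.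
    Hence membership in U descends along the powers of f, starting from
    f^N v = 0. *)
Lemma negative_weight_mem U n N v :
    subspace U -> stable e U -> stable f U ->
    h v = - n.+1%:R *: v -> iter N f v = 0 ->
  U (e v) -> U v.
Proof.
move=> sU eU fU hv fN Uev.
have step k : U (iter k.+1 f v) -> U (iter k f v).
  move=> /eU; rewrite (e_iter_f _ hv) => Usum.
  apply: (@subspace_scale_inv _ _ _ (k.+1%:R * (- n.+1%:R - k%:R))) => //.
    rewrite mulf_neq0 ?natrS_neq0 // -opprD oppr_eq0 -natrD addSn.
    exact: natrS_neq0.
  rewrite -[X in U X](addKr (iter k.+1 f (e v))) addrC.
  by apply: subspaceB => //; apply: stable_iter.
have: U (iter N f v) by rewrite fN; case: sU.
by elim: N {fN} => //= k IHk /step.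
Qed.

(** The lift is the extremal projector applied to v.  The terms of positive
    index involve e v and lie in U; the coefficients make the images under e of
    consecutive terms telescope, and their denominators do not vanish because
    the weight is nonnegative. *)
Lemma lift_highest_weight U m N v :
    subspace U -> stable e U -> stable f U ->
    h v = m%:R *: v -> iter N e v = 0 -> U (e v) ->
  exists v0, [/\ h v0 = m%:R *: v0, e v0 = 0 & U (v - v0)].
Proof.
move=> sU eU fU hv eN Uev.
pose T k := iter k f (iter k e v).
(* c k is (-1)^k / (k! (m + 2) (m + 3) ... (m + k + 1)) *)
pose c := fix c k : K :=
  if k is k'.+1 then - c k' / (k'.+1%:R * (m%:R + k'.+2%:R)) else 1.
have hek k := weight_iter_e k hv.
have hT k : h (T k) = m%:R *: T k.
  by rewrite (weight_iter_f k (hek k)) addrK.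
have eT k : e (\sum_(j < k.+1) c j *: T j) = c k *: iter k f (iter k.+1 e v).
  elim: k => [|k IHk]; first by rewrite big_ord1 linearZ.
  rewrite big_ord_recr linearD IHk linearZ_LR.
  rewrite [e (T _)](e_iter_f _ (hek k.+1)) scalerDr addrCA scalerA.
  rewrite -[iter k f (iter k.+1 e v)]/(iter k f (e (iter k e v))) -scalerDl.
  set d : K := k.+1%:R * (_ - _).
  have dE : d = k.+1%:R * (m%:R + k.+2%:R).
    congr (_ * _); rewrite -addrA; congr (_ + _).
    by rewrite -natrB; [congr (_%:R); lia|lia].
  have d0 : d != 0.
    by rewrite dE mulf_neq0 ?natrS_neq0 // -natrD addnS natrS_neq0.
  by rewrite /= -dE divfK // subrr scale0r addr0.
exists (\sum_(j < N.+1) c j *: T j); split.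
- rewrite linear_sum scaler_sumr; apply: eq_bigr => j _.
  by rewrite linearZ /= hT !scalerA mulrC.
- have T0 k : iter k f 0 = 0 by elim: k => //= k ->; rewrite linear0.
  by rewrite eT iterS eN linear0 T0 scaler0.
rewrite big_ord_recl scale1r opprD addrA subrr sub0r.
apply: subspaceN => //; apply: subspace_sum => // j _.
case: (sU) => _ _; apply; apply: stable_iter => //.
by rewrite iterSr; apply: stable_iter.
Qed.
End Sl2.

(** * The action of sl_2 on the free algebra *)

Section Derivations.
Variable K : fieldType.
Implicit Types (u v : freeAlg K).
Local Notation x := (genx K).
Local Notation y := (geny K).

Lemma gen_caseP (P : 'I_2 -> Prop) : P ord0 -> P ord_max -> forall i, P i.
Proof.
move=> P0 P1 [[|[|//]] lti].
  by rewrite (_ : Ordinal _ = ord0) //; apply: val_inj.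
by rewrite (_ : Ordinal _ = ord_max) //; apply: val_inj.
Qed.

Lemma freeAlg_xy_ind (P : freeAlg K -> Prop) :
    (forall u v, P u -> P v -> P (u + v)) -> (forall c u, P u -> P (c *: u)) ->
    P 1 -> (forall u, P u -> P (x * u)) -> (forall u, P u -> P (y * u)) ->
  forall u, P u.
Proof.
by move=> PD PZ P1 Px Py; apply: freeAlg_ind => //; apply: gen_caseP.
Qed.

Definition derivation (d : 'I_2 -> freeAlg K) : freeAlg K -> freeAlg K :=
  linext (word_deriv d).

HB.instance Definition _ d := GRing.Linear.on (derivation d).

Lemma derivationD d : {morph derivation d : u v / u + v}.
Proof. exact: linearD. Qed.

Lemma derivationZ d c : {morph derivation d : u / c *: u}.
Proof. by move=> u; apply: linearZ_LR. Qed.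

Lemma derivation1 d : derivation d 1 = 0.
Proof.
have -> : 1 = wordM K [::] by rewrite /wordM big_nil.
by rewrite /derivation linext_wordM.
Qed.

Lemma derivation_genM d i u :
  derivation d (gen K i * u) = d i * u + gen K i * derivation d u.
Proof.
elim/freeAlg_word_ind: u => [u1 u2 h1 h2|c u hu|w].
- rewrite !(mulrDr _ u1) !derivationD h1 h2 (mulrDr _ (derivation d u1)).
  rewrite addrACA; reflexivity.
- rewrite -!(scalerAr c _ u) !derivationZ hu.
  rewrite -(scalerAr c _ (derivation d u)) -scalerDr; reflexivity.
have -> : gen K i * wordM K w = wordM K (i :: w) by rewrite /wordM big_cons.
by rewrite /derivation !linext_wordM.
Qed.

(** Together with [delta] these two derivations form an sl_2-triple acting on
    Kx + Ky by its natural representation. *)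
Definition lowering := derivation (fun i => if i == ord0 then y else 0).
Definition weight := derivation (fun i => if i == ord0 then x else - y).

HB.instance Definition _ := GRing.Linear.on lowering.
HB.instance Definition _ := GRing.Linear.on weight.

Local Notation e := (@delta K).
Local Notation f := lowering.
Local Notation h := weight.

Lemma delta_xM u : e (x * u) = x * e u.
Proof. by rewrite delta_genM eqxx mul0r add0r. Qed.

Lemma delta_yM u : e (y * u) = x * u + y * e u.
Proof. by rewrite delta_genM. Qed.

Lemma loweringD : {morph f : u v / u + v}. Proof. exact: derivationD. Qed.
Lemma loweringZ c : {morph f : u / c *: u}. Proof. exact: derivationZ. Qed.
Lemma weightD : {morph h : u v / u + v}. Proof. exact: derivationD. Qed.
Lemma weightZ c : {morph h : u / c *: u}. Proof. exact: derivationZ. Qed.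

Lemma deltaN : {morph e : u / - u}. Proof. exact: linearN. Qed.
Lemma weightN : {morph h : u / - u}. Proof. exact: linearN. Qed.
Lemma loweringN : {morph f : u / - u}. Proof. exact: linearN. Qed.

Lemma lowering1 : f 1 = 0. Proof. exact: derivation1. Qed.

Lemma lowering_xM u : f (x * u) = y * u + x * f u.
Proof. exact: derivation_genM. Qed.

Lemma lowering_yM u : f (y * u) = y * f u.
Proof. by rewrite [LHS]derivation_genM mul0r add0r. Qed.

Lemma weight1 : h 1 = 0. Proof. exact: derivation1. Qed.

Lemma weight_xM u : h (x * u) = x * u + x * h u.
Proof. exact: derivation_genM. Qed.

Lemma weight_yM u : h (y * u) = - (y * u) + y * h u.
Proof. by rewrite [LHS]derivation_genM mulNr. Qed.

Lemma delta_lowering u : e (f u) = f (e u) + h u.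
Proof.
elim/freeAlg_xy_ind: u => [u v hu hv|c u hu||u hu|u hu].
- rewrite loweringD !deltaD hu hv loweringD weightD addrACA; reflexivity.
- rewrite loweringZ !deltaZ hu loweringZ weightZ scalerDr; reflexivity.
- rewrite lowering1 delta1 weight1 (linear0 e) (linear0 f) addr0; reflexivity.
- rewrite lowering_xM deltaD delta_yM !delta_xM hu lowering_xM weight_xM.
  rewrite mulrDr [LHS](AC (2*2) (2*3*(1*4))) /=; reflexivity.
rewrite lowering_yM delta_yM hu delta_yM loweringD lowering_xM lowering_yM.
rewrite weight_yM mulrDr.
by rewrite [RHS](AC (3*2) ((1*4)*(2*(3*5)))) /= subrr add0r.
Qed.

Lemma weight_delta u : h (e u) = e (h u) + 2 *: e u.
Proof.
elim/freeAlg_xy_ind: u => [u v hu hv|c u hu||u hu|u hu].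
- rewrite deltaD !weightD hu hv !deltaD scalerDr addrACA; reflexivity.
- rewrite deltaZ !weightZ hu deltaZ scalerDr !scalerA mulrC; reflexivity.
- rewrite delta1 weight1 (linear0 e) (linear0 h) scaler0 addr0; reflexivity.
- rewrite delta_xM !weight_xM hu deltaD !delta_xM mulrDr scalerAr addrA.
  reflexivity.
rewrite delta_yM weightD weight_xM !weight_yM hu deltaD deltaN !delta_yM opprD.
rewrite mulrDr -scalerAr scalerDr !scaler_nat !mulr2n.
rewrite [LHS](AC (2*(1*(1*2))) ((3*5)*(1*2*4*6))) /= addNr add0r.
by rewrite [RHS](AC ((2*2)*(2*2)) ((1*5)*((2*7)*(6*3*4*8)))) /= !addNr !add0r.
Qed.

Lemma weight_lowering u : h (f u) = f (h u) - 2 *: f u.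
Proof.
elim/freeAlg_xy_ind: u => [u v hu hv|c u hu||u hu|u hu].
- rewrite loweringD !weightD hu hv !loweringD scalerDr opprD addrACA.
  reflexivity.
- rewrite loweringZ !weightZ hu loweringZ scalerBr !scalerA mulrC; reflexivity.
- rewrite lowering1 weight1 (linear0 f) (linear0 h) scaler0 subr0; reflexivity.
- rewrite lowering_xM weightD !weight_xM weight_yM hu loweringD !lowering_xM.
  rewrite mulrBr -scalerAr scalerDr !scaler_nat !mulr2n !opprD.
  rewrite [LHS](AC (2*(1*(1*2))) ((3*5)*(1*2*4*6))) /= subrr add0r.
  by rewrite [RHS](AC ((2*2)*(2*2)) ((1*5)*((2*7)*(6*3*4*8)))) /= !subrr !add0r.
rewrite lowering_yM !weight_yM hu loweringD loweringN !lowering_yM.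
by rewrite mulrBr scalerAr addrA.
Qed.

Lemma iter_delta_xM k u : iter k e (x * u) = x * iter k e u.
Proof. by elim: k => //= k ->; rewrite delta_xM. Qed.

Lemma iter_delta_yM k u :
  iter k.+1 e (y * u) = y * iter k.+1 e u + k.+1%:R *: (x * iter k e u).
Proof.
elim: k => [|k IHk]; first by rewrite /= delta_yM scale1r addrC.
rewrite iterS IHk deltaD delta_yM deltaZ delta_xM /=.
by rewrite [k.+2%:R]mulrS scalerDl scale1r addrA [_ + y * _]addrC.
Qed.

Lemma iter_lowering_yM k u : iter k f (y * u) = y * iter k f u.
Proof. by elim: k => //= k ->; rewrite lowering_yM. Qed.

Lemma iter_lowering_xM k u :
  iter k.+1 f (x * u) = x * iter k.+1 f u + k.+1%:R *: (y * iter k f u).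
Proof.
elim: k => [|k IHk]; first by rewrite /= lowering_xM scale1r addrC.
rewrite iterS IHk loweringD lowering_xM loweringZ lowering_yM /=.
by rewrite [k.+2%:R]mulrS scalerDl scale1r addrA [_ + x * _]addrC.
Qed.

Lemma derivationM d u v :
  derivation d (u * v) = derivation d u * v + u * derivation d v.
Proof.
elim/freeAlg_ind: u => [u1 u2 h1 h2|c u hu||i u hu].
- rewrite (mulrDl u1) !derivationD h1 h2 (mulrDl (derivation d u1)) (mulrDl u1).
  rewrite addrACA.
  reflexivity.
- rewrite -!(scalerAl c u) !derivationZ hu -(scalerAl c (derivation d u)).
  rewrite -scalerDr.
  reflexivity.
- rewrite derivation1 mul0r !mul1r add0r; reflexivity.
- rewrite -mulrA !derivation_genM hu (mulrDl (_ * u)) (mulrDr (gen K i)).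
  rewrite !mulrA addrA.
  reflexivity.
Qed.

Lemma loweringM u v : f (u * v) = f u * v + u * f v.
Proof. exact: derivationM. Qed.

Lemma weightM u v : h (u * v) = h u * v + u * h v.
Proof. exact: derivationM. Qed.

Lemma weight_x : h x = x.
Proof. by rewrite -[x]mulr1 weight_xM weight1 mulr0 addr0. Qed.
Lemma weight_y : h y = - y.
Proof. by rewrite -[y]mulr1 weight_yM weight1 mulr0 addr0. Qed.
Lemma lowering_x : f x = y.
Proof. by rewrite -[x]mulr1 lowering_xM lowering1 mulr0 addr0 mulr1. Qed.
Lemma lowering_y : f y = 0.
Proof. by rewrite -[y]mulr1 lowering_yM lowering1 mulr0. Qed.

Definition nilpotent_at (L : freeAlg K -> freeAlg K) u : Prop :=
  exists N, forall k, (N <= k)%N -> iter k L u = 0.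

Lemma locally_nilpotent (L : {linear freeAlg K -> freeAlg K}) :
    L 1 = 0 -> (forall u, nilpotent_at L u -> nilpotent_at L (x * u)) ->
    (forall u, nilpotent_at L u -> nilpotent_at L (y * u)) ->
  forall u, nilpotent_at L u.
Proof.
move=> L1 Lx Ly; elim/freeAlg_xy_ind => // [u v [M uM] [N vN]|c u [N uN]|].
- exists (maxn M N) => k; rewrite geq_max => /andP[Mk Nk].
  have -> : iter k L (u + v) = iter k L u + iter k L v.
    by elim: (k) => // j IHj; rewrite !iterS IHj linearD.
  by rewrite uM // vN // addr0.
- exists N => k Nk; have -> : iter k L (c *: u) = c *: iter k L u.
    by elim: (k) => // j IHj; rewrite !iterS IHj linearZ_LR.
  by rewrite uN // scaler0.
exists 1%N => -[//|k _]; rewrite iterSr L1.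
by elim: k => // k IHk; rewrite iterS IHk linear0.
Qed.

Lemma delta_locally_nilpotent u : nilpotent_at e u.
Proof.
apply: (@locally_nilpotent e) u => [|u [N uN]|u [N uN]]; first exact: delta1.
  by exists N => k Nk; rewrite iter_delta_xM uN // mulr0.
exists N.+1 => -[//|k Nk].
by rewrite iter_delta_yM !uN ?mulr0 ?scaler0 ?addr0 // ltnW.
Qed.

Lemma lowering_locally_nilpotent u : nilpotent_at f u.
Proof.
apply: (@locally_nilpotent f) u => [|u [N uN]|u [N uN]]; first exact: lowering1.
  exists N.+1 => -[//|k Nk].
  by rewrite iter_lowering_xM !uN ?mulr0 ?scaler0 ?addr0 // ltnW.
by exists N => k Nk; rewrite iter_lowering_yM uN // mulr0.
Qed.
End Derivations.

(** * Noncrossing products *)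

(** The inductive step of [noncrossing_transvection] through a letter x: with v
    and w standing for h u and f u, the left side is y i h(x u) - x i f(x u). *)
Lemma cup_identity (R : pzRingType) (x y i u v w : R) :
  y * i * (x * u + x * v) - x * i * (y * u + x * w) =
  (y * i * x - x * i * y) * (u + v) + x * (i * (y * v - x * w)).
Proof.
rewrite !mulrDr !mulrBl !mulrN !mulrA opprD !addrA.
by rewrite subrK [LHS](ACl (1*3*2*4)).
Qed.

Section Noncrossing.
Variable K : fieldType.
Implicit Types (u v : freeAlg K).
Local Notation x := (genx K).
Local Notation y := (geny K).
Local Notation e := (@delta K).
Local Notation f := (@lowering K).
Local Notation h := (@weight K).

Definition cup u : freeAlg K := y * u * x - x * u * y.

(** Parallel and nested cups: the letters of such an element are matched
    without crossing, each pair being antisymmetrized. *)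
Inductive cup_monomial : freeAlg K -> Prop :=
| cup_monomial1 : cup_monomial 1
| cup_monomialA i : cup_monomial i -> cup_monomial (cup i)
| cup_monomialM i j :
    cup_monomial i -> cup_monomial j -> cup_monomial (i * j).

(** The subalgebra generated by x and the cup monomials, presented by left
    multiplications so that induction peels off one generator at a time. *)
Inductive noncrossing_span : freeAlg K -> Prop :=
| noncrossing1 : noncrossing_span 1
| noncrossingD u v :
    noncrossing_span u -> noncrossing_span v -> noncrossing_span (u + v)
| noncrossingZ c u : noncrossing_span u -> noncrossing_span (c *: u)
| noncrossing_xM u : noncrossing_span u -> noncrossing_span (x * u)
| noncrossingM i u :
    cup_monomial i -> noncrossing_span u -> noncrossing_span (i * u).

Lemma weight_cup_monomial i : cup_monomial i -> h i = 0.
Proof.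
elim=> [|{}i _ hi|{}i j _ hi _ hj]; first exact: weight1.
  rewrite /cup weightD weightN -!mulrA weight_xM weight_yM !weightM hi.
  by rewrite weight_x weight_y !mul0r !add0r !mulrN addNr subrr subr0.
by rewrite weightM hi hj mul0r mulr0 addr0.
Qed.

Lemma lowering_cup_monomial i : cup_monomial i -> f i = 0.
Proof.
elim=> [|{}i _ hi|{}i j _ hi _ hj]; first exact: lowering1.
  rewrite /cup loweringD loweringN -!mulrA lowering_xM lowering_yM !loweringM.
  by rewrite hi lowering_x lowering_y !mul0r !add0r !mulr0 addr0 subrr.
by rewrite loweringM hi hj mul0r mulr0 addr0.
Qed.

Lemma noncrossing_weight u : noncrossing_span u -> noncrossing_span (h u).
Proof.
elim=> [|{}u v _ hu _ hv|c {}u _ hu|{}u Cu hu|i {}u Ji _ hu].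
- by rewrite weight1 -(scale0r 1); do 2 constructor.
- by rewrite weightD; constructor.
- by rewrite weightZ; constructor.
- by rewrite weight_xM; do 2 constructor.
- by rewrite weightM (weight_cup_monomial Ji) mul0r add0r; constructor.
Qed.

(** The case i = 1 is the one of interest.  The additional factor i collects the
    cup monomials met on the way to the next letter x, where it is closed up
    into [cup i]. *)
Lemma noncrossing_transvection u : noncrossing_span u ->
  forall i, cup_monomial i -> noncrossing_span (y * i * h u - x * i * f u).
Proof.
elim=> [|{}u v _ hu _ hv|c {}u _ hu|{}u Cu hu|j {}u Jj _ hu] i Ji.
- rewrite weight1 lowering1 !mulr0 subr0 -(scale0r 1); do 2 constructor.
- by rewrite weightD loweringD !mulrDr opprD addrACA; constructor; auto.
- rewrite weightZ loweringZ -!scalerAr -scalerBr; constructor; auto.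
- have -> : y * i * h (x * u) - x * i * f (x * u) =
      cup i * (u + h u) + x * (i * (y * 1 * h u - x * 1 * f u)).
    by rewrite weight_xM lowering_xM !mulr1; apply: cup_identity.
  constructor; last by do 2!constructor => //; apply: hu; constructor.
  by do 2 constructor => //; apply: noncrossing_weight.
rewrite weightM loweringM (weight_cup_monomial Jj) (lowering_cup_monomial Jj).
rewrite !mul0r !add0r !mulrA -2!(mulrA _ i j).
by apply: hu; constructor.
Qed.
End Noncrossing.

(** * Highest weight vectors of the free algebra *)

Section HighestWeight.
Variable K : fieldType.
Hypothesis charK : [pchar K] =i pred0.
Implicit Types (u v a b : freeAlg K).
Local Notation x := (genx K).
Local Notation y := (geny K).
Local Notation e := (@delta K).
Local Notation f := (@lowering K).
Local Notation h := (@weight K).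

(** The left inverse of multiplication by [gen i]; it makes the decomposition
    c + x a + y b unique. *)
Definition strip i : freeAlg K -> freeAlg K :=
  linext (fun w =>
    if w is j :: w' then (if j == i then wordM K w' else 0) else 0).

Lemma stripD i : {morph strip i : u v / u + v}.
Proof. exact: linearD. Qed.

Lemma stripZ i c : {morph strip i : u / c *: u}.
Proof. by move=> u; apply: linearZ_LR. Qed.

Lemma strip1 i : strip i 1 = 0.
Proof.
have -> : 1 = wordM K [::] by rewrite /wordM big_nil.
by rewrite /strip linext_wordM.
Qed.

Lemma strip_genM i j u : strip i (gen K j * u) = if j == i then u else 0.
Proof.
elim/freeAlg_word_ind: u => [u v hu hv|c u hu|w].
- by rewrite mulrDr stripD hu hv; case: ifP; rewrite ?addr0.
- by rewrite -scalerAr stripZ hu; case: ifP; rewrite ?scaler0.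
have -> : gen K j * wordM K w = wordM K (j :: w) by rewrite /wordM big_cons.
by rewrite /strip linext_wordM.
Qed.

Lemma strip_decomp c a b :
  (strip ord0 (c *: 1 + x * a + y * b) = a) *
  (strip ord_max (c *: 1 + x * a + y * b) = b).
Proof.
by split; rewrite !stripD stripZ strip1 scaler0 add0r !strip_genM /=
  ?addr0 ?add0r.
Qed.

(** A recursive form of the degree filtration, giving the decomposition on which
    the induction in [highest_weight_noncrossing] runs. *)
Fixpoint degree_lt n v : Prop :=
  if n is n'.+1 then
    exists c a b,
      [/\ v = c *: 1 + x * a + y * b, degree_lt n' a & degree_lt n' b]
  else v = 0.

Lemma degree_ltS n v : degree_lt n v -> degree_lt n.+1 v.
Proof.
elim: n v => [_ ->|n IHn v [c [a [b [-> /IHn da /IHn db]]]]].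
  by exists 0, 0, 0; rewrite scale0r !mulr0 !addr0.
by exists c, a, b.
Qed.

Lemma degree_ltW m n v : (m <= n)%N -> degree_lt m v -> degree_lt n v.
Proof.
by move=> /subnK <-; elim: (n - m)%N => // k IHk /IHk /degree_ltS.
Qed.

Lemma degree_ltD n u v : degree_lt n u -> degree_lt n v -> degree_lt n (u + v).
Proof.
elim: n u v => [u v -> ->|n IHn u v]; first exact: addr0.
move=> [c [a [b [-> da db]]]] [c' [a' [b' [-> da' db']]]].
exists (c + c'), (a + a'), (b + b'); split; try exact: IHn.
by rewrite scalerDl !mulrDr addrACA [X in X + _]addrACA.
Qed.

Lemma degree_ltZ n k v : degree_lt n v -> degree_lt n (k *: v).
Proof.
elim: n v => [v ->|n IHn v [c [a [b [-> da db]]]]]; first exact: scaler0.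
exists (k * c), (k *: a), (k *: b); split; try exact: IHn.
by rewrite !scalerDr scalerA !scalerAr.
Qed.

Lemma degree_lt_lowering n v : degree_lt n v -> degree_lt n (f v).
Proof.
elim: n v => [v ->|n IHn v [c [a [b [-> da db]]]]]; first exact: linear0.
exists 0, (f a), (a + f b); split; last 2 first.
- exact: IHn.
- by apply: degree_ltD => //; apply: IHn.
rewrite !loweringD loweringZ lowering1 scaler0 scale0r !add0r.
by rewrite lowering_xM lowering_yM mulrDr addrA [y * a + _]addrC.
Qed.

Lemma degree_ltP v : exists n, degree_lt n v.
Proof.
elim/freeAlg_xy_ind: v => [u v [m du] [n dv]|c u [n du]||u [n du]|u [n du]].
- exists (maxn m n); apply: degree_ltD.
    by apply: degree_ltW du; apply: leq_maxl.
  by apply: degree_ltW dv; apply: leq_maxr.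
- by exists n; apply: degree_ltZ.
- by exists 1%N, 1, 0, 0; rewrite scale1r !mulr0 !addr0.
- exists n.+1, 0, u, 0; rewrite scale0r mulr0 addr0 add0r; split=> //.
  by apply: (@degree_ltW 0).
- exists n.+1, 0, 0, u; rewrite scale0r mulr0 addr0 add0r; split=> //.
  by apply: (@degree_ltW 0).
Qed.

Lemma subspace0 : subspace (fun v : freeAlg K => v = 0).
Proof.
split=> // [u v -> ->|c u ->]; [exact: addr0 | exact: scaler0].
Qed.

Lemma negative_highest_weight_eq0 n v :
  h v = - n.+1%:R *: v -> e v = 0 -> v = 0.
Proof.
have [N fN] := lowering_locally_nilpotent v => hv ev.
have ef := @delta_lowering K; have hf := @weight_lowering K.
apply: (negative_weight_mem charK ef hf subspace0 _ _ hv (fN N (leqnn N)) ev).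
  by move=> _ ->; apply: linear0.
by move=> _ ->; apply: linear0.
Qed.

(** The induction is on the degree.  Comparing the coefficients of x and y in
    e v = 0 and in h v = m v gives b = - e a and the weights of a and b; adding
    a multiple of f b to a then produces a highest weight vector a0, and what
    remains of v is, up to a factor, y h b - x f b. *)
Lemma highest_weight_noncrossing m v :
  h v = m%:R *: v -> e v = 0 -> noncrossing_span v.
Proof.
have [n] := degree_ltP v; elim: n m v => [|n IHn] m v.
  by move=> -> _ _; rewrite -(scale0r 1); do 2 constructor.
move=> [c [a [b [-> da db]]]] hv ev.
have evE : 0 *: 1 + x * (e a + b) + y * e b = e (c *: 1 + x * a + y * b).
  rewrite !deltaD deltaZ delta1 scaler0 scale0r !add0r delta_xM delta_yM.
  by rewrite mulrDr addrA.
have hvE : 0 *: 1 + x * (a + h a) + y * (h b - b) = h (c *: 1 + x * a + y * b).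
  rewrite !weightD weightZ weight1 scaler0 scale0r !add0r weight_xM weight_yM.
  by rewrite !mulrDr mulrN [y * h b - _]addrC.
have eab : e a + b = 0.
  have := congr1 (strip ord0) evE; rewrite ev strip_decomp => ->.
  exact: linear0.
have eb : e b = 0.
  have := congr1 (strip ord_max) evE; rewrite ev strip_decomp => ->.
  exact: linear0.
have ha : a + h a = m%:R *: a.
  have := congr1 (strip ord0) hvE.
  by rewrite hv stripZ !strip_decomp.
have hb : h b = m.+1%:R *: b.
  have := congr1 (strip ord_max) hvE.
  rewrite hv stripZ !strip_decomp => /eqP; rewrite subr_eq => /eqP ->.
  by rewrite -addn1 natrD scalerDl scale1r.
have m0 := natrS_neq0 charK m.
pose a0 := a + m.+1%:R^-1 *: f b.
have ea0 : e a0 = 0.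
  rewrite deltaD deltaZ delta_lowering eb (linear0 f) add0r hb scalerA mulVf //.
  by rewrite scale1r.
have ha0 : a0 + h a0 = m%:R *: a0.
  rewrite weightD addrACA ha scalerDr; congr (_ + _).
  rewrite weightZ weight_lowering hb loweringZ -scalerBl -scalerDr.
  rewrite -[X in X + _]scale1r -scalerDl scalerA scalerA mulrC.
  by congr (_ *: _); congr (_ * _); rewrite -addn1 natrD; ring.
have da0 : degree_lt n a0.
  by apply: degree_ltD => //; apply: degree_ltZ; apply: degree_lt_lowering.
(* For m = 0 the vector a0 has weight -1, so it vanishes. *)
have Ca0 : noncrossing_span a0.
  case: (m) ha0 => [|m'] ha0.
    rewrite (@negative_highest_weight_eq0 0 a0) // ?scaleN1r.
      by rewrite -(scale0r 1); do 2 constructor.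
    by apply/eqP; rewrite -addr_eq0 addrC ha0 scale0r.
  apply: (IHn m') => //; apply: (addrI a0).
  by rewrite ha0 mulrS scalerDl scale1r.
have Cb : noncrossing_span b by apply: (IHn m.+1).
have -> : c *: 1 + x * a + y * b =
    c *: 1 + x * a0 + m.+1%:R^-1 *: (y * 1 * h b - x * 1 * f b).
  rewrite !mulr1 hb -scalerAr scalerBr scalerA mulVf // scale1r mulrDr.
  rewrite -scalerAr.
  by rewrite -!addrA; congr (_ + (_ + _)); rewrite addrCA subrr addr0.
constructor; first by do 2 constructor => //; constructor.
constructor; apply: noncrossing_transvection => //; constructor.
Qed.

Definition word_weight (w : seq 'I_2) : int :=
  \sum_(i <- w) (if i == ord0 then 1 else -1).

Lemma weight_wordM w : h (wordM K w) = (word_weight w)%:~R *: wordM K w.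
Proof.
rewrite /word_weight; elim: w => [|i w IHw].
  by rewrite /wordM !big_nil scale0r weight1.
have -> : wordM K (i :: w) = gen K i * wordM K w by rewrite /wordM big_cons.
rewrite big_cons intrD scalerDl; elim/gen_caseP: i => /=.
  by rewrite weight_xM IHw -scalerAr scale1r.
by rewrite weight_yM IHw -scalerAr scaleN1r.
Qed.

(** * Lifting constants *)

Definition sl2_stable (U : freeAlg K -> Prop) : Prop :=
  [/\ subspace U, stable e U & stable f U].

Lemma sl2_stable_weight U : sl2_stable U -> stable h U.
Proof.
case=> sU eU fU v Uv; rewrite -[h v](addKr (f (e v))) -delta_lowering addrC.
by apply: subspaceB => //; [apply/eU/fU | apply/fU/eU].
Qed.

Lemma weight_vector_lift U (z : int) v :
    sl2_stable U -> h v = z%:~R *: v -> U (e v) ->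
  exists c, noncrossing_span c /\ U (v - c).
Proof.
move=> [sU eU fU] hv Uev.
have ef := @delta_lowering K; have hf := @weight_lowering K.
have he := @weight_delta K.
case: z hv => [m|n] hv.
  have [N eN] := delta_locally_nilpotent v.
  have [c [hc ec Uc]] :=
    lift_highest_weight charK ef he hf sU eU fU hv (eN N (leqnn N)) Uev.
  by exists c; split=> //; apply: highest_weight_noncrossing hc ec.
have [N fN] := lowering_locally_nilpotent v.
exists 0; split; first by rewrite -(scale0r 1); do 2 constructor.
rewrite NegzE mulrNz in hv; rewrite subr0.
exact: (negative_weight_mem charK ef hf sU eU fU hv (fN N (leqnn N)) Uev).
Qed.

(** The elements sent into U by e form a subspace stable under h, so it contains
    the weight components of v, and each component lifts by
    [weight_vector_lift]. *)
Lemma constant_mod_lift U v :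
  sl2_stable U -> U (e v) -> exists c, noncrossing_span c /\ U (v - c).
Proof.
move=> slU; case: (slU) => sU eU fU Uev.
pose T v := exists c, noncrossing_span c /\ U (v - c).
have T0 : T 0.
  exists 0; rewrite subr0 -{1}(scale0r 1); split; first by do 2 constructor.
  by case: sU.
have TD u1 u2 : T u1 -> T u2 -> T (u1 + u2).
  move=> [c1 [C1 U1]] [c2 [C2 U2]]; exists (c1 + c2); split.
    by constructor.
  by rewrite opprD addrACA; case: sU => _ UD _; apply: UD.
pose Ue u := U (e u).
have sUe : subspace Ue.
  case: sU => U0 UD UZ; split=> [|u1 u2|c u].
  - by rewrite /Ue (linear0 e).
  - by rewrite /Ue deltaD; apply: UD.
  - by rewrite /Ue deltaZ; apply: UZ.
have hUe : stable h Ue.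
  move=> u Uu; rewrite /Ue -[e (h u)](addrK (2 *: e u)) -weight_delta.
  apply: subspaceB => //; first exact: sl2_stable_weight.
  by case: sU => _ _; apply.
(* The words are eigenvectors of h; grouping those of equal weight in the
   support of v gives its weight components. *)
pose mu (m : {fmonom 'I_2}) := (word_weight m)%:~R : K.
pose w m := v@_m *: wordM K m.
pose r : seq {fmonom 'I_2} := msupp v.
have vE : v = \sum_(m <- r) w m.
  by rewrite {1}[v]monalgE; apply: eq_bigr => m _; apply: monomE.
have hw m : h (w m) = mu m *: w m.
  by rewrite weightZ weight_wordM !scalerA mulrC.
rewrite vE (sum_by_eigenvalue _ mu); apply: (big_ind T) => // z _.
have [|neg] := boolP (has (fun m => mu m == z) r); last first.
  rewrite big1_seq // => m /andP[mz mv]; case/negP: neg.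
  by apply/hasP; exists m.
case/hasP=> m0 _ /eqP <-; apply: (@weight_vector_lift _ (word_weight m0)) => //.
  rewrite linear_sum scaler_sumr; apply: eq_bigr => m /eqP mz.
  by rewrite [LHS]hw mz.
apply: (eigencomponents_mem sUe hUe hw); rewrite -vE; exact: Uev.
Qed.
End HighestWeight.

(** * The action of GL_2 *)

Lemma alternating_form (K : fieldType) (A : algType K) (x y u : A)
    (a b c d : K) :
  (b *: x + d *: y) * u * (a *: x + c *: y) -
  (a *: x + c *: y) * u * (b *: x + d *: y) =
  (a * d - b * c) *: (y * u * x - x * u * y).
Proof.
rewrite !mulrDl !mulrDr -!scalerAl -!scalerAr !scalerA !opprD.
rewrite [LHS](AC ((2*2)*(2*2)) ((1*5)*(4*8)*((2*6)*(3*7)))) /=.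
rewrite [b * a]mulrC [d * c]mulrC !subrr !add0r scalerBr !scalerBl.
by rewrite addrC opprB [d * a]mulrC [c * b]mulrC.
Qed.

Section GroupAction.
Variable K : fieldType.
Implicit Types (u v : freeAlg K) (a b c d : K) (g : 'M[K]_2).
Local Notation x := (genx K).
Local Notation y := (geny K).
Local Notation e := (@delta K).
Local Notation f := (@lowering K).

Lemma gl_actD g : {morph gl_act g : u v / u + v}. Proof. exact: substD. Qed.
Lemma gl_actN g : {morph gl_act g : u / - u}. Proof. exact: rmorphN. Qed.
Lemma gl_actZ g c : {morph gl_act g : u / c *: u}. Proof. exact: substZ. Qed.
Lemma gl_act1 g : gl_act g 1 = 1. Proof. exact: subst1. Qed.
Lemma gl_actM g : {morph gl_act g : u v / u * v}. Proof. exact: rmorphM. Qed.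

Lemma gl_act_gen g j :
  gl_act g (gen K j) = g ord0 j *: x + g ord_max j *: y.
Proof.
rewrite /gl_act subst_gen !big_ord_recl big_ord0 addr0.
by congr (_ + _ *: gen K _); [congr (g _ j)|]; apply: val_inj.
Qed.

Lemma det2 g :
  \det g = g ord0 ord0 * g ord_max ord_max - g ord0 ord_max * g ord_max ord0.
Proof.
rewrite (expand_det_row _ ord0) !big_ord_recl big_ord0 addr0 /cofactor.
rewrite !det_mx11 !mxE expr0 expr1 mul1r mulN1r mulrN.
by congr (_ * g _ _ - g _ _ * g _ _); apply: val_inj.
Qed.

Lemma gl_act_cup g u :
  gl_act g u = u -> gl_act g (cup u) = \det g *: cup u.
Proof.
move=> gu; rewrite /cup gl_actD gl_actN !gl_actM gu !gl_act_gen.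
by rewrite alternating_form det2.
Qed.

(** Exchanging x and y turns delta into the lowering derivation, so that an
    invariant ideal is stable under the latter as well. *)
Definition swap : 'M[K]_2 := \matrix_(i, j) (i != j)%:R.

Lemma swap_unit : swap \in unitmx.
Proof. by rewrite unitmxE det2 !mxE /= mul0r sub0r mulr1 unitrN1. Qed.

Lemma swap_x : gl_act swap x = y.
Proof. by rewrite gl_act_gen !mxE /= scale0r add0r scale1r. Qed.

Lemma swap_y : gl_act swap y = x.
Proof. by rewrite gl_act_gen !mxE /= scale0r addr0 scale1r. Qed.

Lemma swapK : involutive (gl_act swap).
Proof.
elim/freeAlg_xy_ind => [u v hu hv|c u hu||u hu|u hu].
- by rewrite !gl_actD hu hv.
- by rewrite !gl_actZ hu.
- by rewrite !gl_act1.
- by rewrite !gl_actM swap_x swap_y hu.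
- by rewrite !gl_actM swap_y swap_x hu.
Qed.

Lemma lowering_swap u : f u = gl_act swap (e (gl_act swap u)).
Proof.
elim/freeAlg_xy_ind: u => [u v hu hv|c u hu||u hu|u hu].
- by rewrite gl_actD deltaD gl_actD loweringD hu hv.
- by rewrite gl_actZ deltaZ gl_actZ loweringZ hu.
- by rewrite gl_act1 delta1 lowering1; symmetry; apply: linear0.
- rewrite gl_actM swap_x delta_yM gl_actD !gl_actM swap_x swap_y swapK -hu.
  exact: lowering_xM.
- by rewrite gl_actM swap_y delta_xM gl_actM swap_x -hu lowering_yM.
Qed.

(** The matrix of x |-> x, y |-> x + y. *)
Definition shear : 'M[K]_2 := \matrix_(i, j) (i <= j)%N%:R.

Lemma det_shear : \det shear = 1.
Proof. by rewrite det2 !mxE /= mulr0 subr0 mulr1. Qed.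

Lemma shear_x : gl_act shear x = x.
Proof. by rewrite gl_act_gen !mxE /= scale0r addr0 scale1r. Qed.

Lemma shear_y : gl_act shear y = y + x.
Proof. by rewrite gl_act_gen !mxE /= !scale1r addrC. Qed.

(** The shear is exp delta: on a letter both are 1 + delta, and the Leibniz rule
    for the powers of delta makes the exponential multiplicative.  The
    identity is stated for all large truncations M, so that two elements can
    share one. *)
Lemma shear_exp (charK : [pchar K] =i pred0) u :
  exists N, forall M, (N <= M)%N ->
    gl_act shear u = \sum_(k < M) (k`!%:R)^-1 *: iter k e u.
Proof.
elim/freeAlg_xy_ind: u => [u v [M uM] [N vN]|c u [N uN]||u [N uN]|u [N uN]].
- exists (maxn M N) => k; rewrite geq_max => /andP[Mk Nk].
  rewrite gl_actD (uM k) // (vN k) // -big_split; apply: eq_bigr => j _ /=.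
  rewrite -scalerDr; congr (_ *: _).
  by elim: (j : nat) => //= i <-; rewrite deltaD.
- exists N => k Nk; rewrite gl_actZ (uN k) // scaler_sumr.
  apply: eq_bigr => j _.
  rewrite scalerA mulrC -scalerA; congr (_ *: _).
  by elim: (j : nat) => //= i <-; rewrite deltaZ.
- exists 1%N => -[//|k _]; rewrite gl_act1 big_ord_recl /= invr1 scale1r.
  rewrite big1 ?addr0 // => j _; rewrite -iterS iterSr delta1.
  have -> : iter j e 0 = 0 by elim: (j : nat) => //= i ->; apply: linear0.
  exact: scaler0.
- exists N => k Nk; rewrite gl_actM shear_x (uN k) // mulr_sumr.
  by apply: eq_bigr => j _; rewrite iter_delta_xM scalerAr.
exists N.+1 => -[//|k Nk]; rewrite gl_actM shear_y mulrDl.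
rewrite {1}(uN k.+1) 1?ltnW // (uN k) // !big_ord_recl /= mulrDr -addrA.
congr (_ + _); first by rewrite -scalerAr.
rewrite !mulr_sumr -big_split; apply: eq_bigr => j _ /=.
rewrite -iterS -(iterS j e (y * u)) iter_delta_yM scalerDr -!scalerAr scalerA.
congr (_ + _ *: _).
rewrite /bump leq0n add1n factS natrM invfM mulrAC mulVf ?mul1r //.
exact: natrS_neq0.
Qed.
End GroupAction.

(** * Constants of the quotient *)

Section Constants.
Variable K : fieldType.
Hypothesis charK : [pchar K] =i pred0.
Variable I : ideal K.
Hypothesis invI : GL2_invariant I.

Lemma ideal_subspace : subspace I.
Proof.
split=> [|u v|c u]; [exact: ideal0 | exact: idealD | exact: idealZ].
Qed.

Lemma ideal_sl2_stable : sl2_stable I.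
Proof.
split; [exact: ideal_subspace | by move=> v; apply: delta_ideal |].
move=> v Iv; rewrite lowering_swap; apply: invI (swap_unit _) _ _.
by apply: delta_ideal => //; apply: invI => //; apply: swap_unit.
Qed.

(** Invariance under the shear exp delta already suffices, by
    [unipotent_mem]. *)
Lemma SL2_invariant_constant (b : quotAlg I) : SL2_invariant b -> is_constant b.
Proof.
rewrite -(repr_proj b); set v := repr b => /(_ _ (det_shear K)).
rewrite quot_actE ?unitmxE ?det_shear ?unitr1 // => /projP Iuv.
rewrite /is_constant quot_deltaE //; apply/proj_eq0.
have [N uN] := shear_exp charK v; have [M eM] := delta_locally_nilpotent v.
pose c k : K := (k.+1`!%:R)^-1; pose k := maxn N M.
have sI := ideal_subspace; have [_ eI _] := ideal_sl2_stable.
apply: (@unipotent_mem _ _ (@delta K) I k c) => //.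
- by rewrite /c invr1 oner_neq0.
- by move=> j kj; apply/eM/leqW/(leq_trans _ kj)/leq_maxr.
move: Iuv; rewrite (uN k.+1) ?leqW ?leq_maxl // big_ord_recl /= invr1 scale1r.
by rewrite addrAC subrr add0r.
Qed.

Lemma constants_subalgebra (S : quotAlg I -> Prop) a :
  (forall b, S b -> is_constant b) -> subalgebra_of S a -> is_constant a.
Proof.
move=> Sconst; elim=> {a} [b /Sconst //||a b _ + _|c a _|a b _ + _].
- rewrite /is_constant -proj_one quot_deltaE // delta1.
  by apply/proj_eq0/ideal0.
- rewrite -(repr_proj a) -(repr_proj b) -projD /is_constant !quot_deltaE //.
  by rewrite deltaD projD => -> ->; rewrite addr0.
- rewrite -(repr_proj a) -projZ /is_constant !quot_deltaE // deltaZ projZ => ->.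
  exact: scaler0.
rewrite -(repr_proj a) -(repr_proj b) -projM /is_constant !quot_deltaE //.
by rewrite deltaM projD !projM => -> ->; rewrite mul0r mulr0 addr0.
Qed.

Lemma SL2_invariant_cup_monomial u :
  cup_monomial u -> SL2_invariant (proj I u).
Proof.
move=> Ju g det_g; rewrite quot_actE ?unitmxE ?det_g ?unitr1 //; congr proj.
elim: Ju => [|{}u _ gu|{}u v _ gu _ gv]; first exact: gl_act1.
  by rewrite gl_act_cup // det_g scale1r.
by rewrite gl_actM gu gv.
Qed.

Lemma noncrossing_subalgebra u : noncrossing_span u ->
  subalgebra_of (fun b => b = proj I (genx K) \/ SL2_invariant b) (proj I u).
Proof.
elim=> [|{}u v _ hu _ hv|c {}u _ hu|{}u _ hu|i {}u Ji _ hu].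
- exact: subalg_one.
- by rewrite projD; apply: subalg_add.
- by rewrite projZ; apply: subalg_scale.
- by rewrite projM; apply: subalg_mul => //; apply: subalg_gen; left.
rewrite projM; apply: subalg_mul => //; apply: subalg_gen; right.
exact: SL2_invariant_cup_monomial.
Qed.
End Constants.

Theorem corollary5p6 (K : fieldType) (charK : [pchar K] =i pred0)
    (I : ideal K) (invI : GL2_invariant I) (a : quotAlg I) :
  is_constant a <->
  subalgebra_of (fun b : quotAlg I => b = proj I (genx K) \/ SL2_invariant b) a.
Proof.
split=> [|].
  rewrite -(repr_proj a) /is_constant quot_deltaE // => /proj_eq0 Iea.
  have [c [Cc /projP ->]] :=
    constant_mod_lift charK (ideal_sl2_stable charK invI) Iea.
  exact: noncrossing_subalgebra.
apply: constants_subalgebra => // b [->|]; last exact: SL2_invariant_constant.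
by rewrite /is_constant quot_deltaE // delta_genx; apply/proj_eq0/ideal0.
Qed.
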